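(* Let $|\psi\rangle$ be an $n$-qubit stabilizer state and $\mathbb{D}$ a set of detectors for $|\psi\rangle$. Let $D\subseteq\mathbb{D}$ and let $G$ be an error generator, i.e. a real linear combination of elementary error generators, all of whose elementary error generators belong to the DEM event class of $D$. Let $\mathcal{E}_D=\exp(G)$. Then for every $P\in D$ the circuit error $\mathcal{E}_D$ is perfectly modeled by the DEM consisting of the single event $D$ with probability $$p_D=\tfrac12\left(1-\mathrm{Tr}\left(P\,\mathcal{E}_D[|\psi\rangle\langle\psi|]\right)\right).$$ That is, the detection history of $\mathcal{E}_D[|\psi\rangle\langle\psi|]$ equals $D$ with probability $p_D$, equals $\emptyset$ with probability $1-p_D$, and takes any other value with probability $0$.
   Context: Paulis: $n$-qubit Pauli operators are tensor products of $I,X,Y,Z$, possibly with a sign $\pm1$. Detectors: $|\psi\rangle$ is the state produced by the error-free circuit just before the final measurement. A detector is a signed Pauli operator $P$ with $\langle\psi|P|\psi\rangle=1$ (so $P|\psi\rangle=|\psi\rangle$). $\mathbb{D}$ is a finite set of pairwise commuting, multiplicatively independent detectors. Detection history: for a linear map $\mathcal{F}$ on operators, the detection history of $\mathcal{F}[|\psi\rangle\langle\psi|]$ is the subset $S\subseteq\mathbb{D}$ of detectors whose measured outcome is $-1$ (flipped). It has probability $\mathrm{Tr}(\Pi_S\,\mathcal{F}[|\psi\rangle\langle\psi|])$, where $\Pi_S=\prod_{P\in S}\frac{I-P}{2}\prod_{P\in\mathbb{D}\setminus S}\frac{I+P}{2}$. Elementary error generators (EEGs) are the following linear maps on operators, indexed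 by non-identity Paulis $P$ (or pairs of distinct non-identity Paulis $P,Q$): $H_P[\rho]=-i[P,\rho]$; $S_P[\rho]=P\rho P-\rho$; $C_{P,Q}[\rho]=P\rho Q+Q\rho P-\frac12\{\{P,Q\},\rho\}$; $A_{P,Q}[\rho]=i\left(P\rho Q-Q\rho P+\frac12\{[P,Q],\rho\}\right)$. For a Pauli $Q$, $\Delta(Q)=\{P\in\mathbb{D}: [P,Q]\ne0\}$. The DEM event class of $D\subseteq\mathbb{D}$ is the set of all EEGs all of whose Pauli indices $P$ satisfy $\Delta(P)=D$. Detector error model (DEM): a set of events $D_i\subseteq\mathbb{D}$ with probabilities $p_i$. Each event occurs independently with its probability, and the detection history is the symmetric difference of the events that occur. *)

(* Defs.v *)
From HB Require Import structures.
From mathcomp Require Import all_boot all_order all_algebra.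
From mathcomp Require Import spectral.
From mathcomp Require Import all_classical all_reals all_analysis.
From mathcomp Require Import mxtens complex.

Set Implicit Arguments.
Unset Strict Implicit.
Unset Printing Implicit Defensive.

Import Order.TTheory GRing.Theory Num.Theory.
Import numFieldNormedType.Exports.

Local Open Scope classical_set_scope.
Local Open Scope ring_scope.
Local Open Scope sesquilinear_scope.

(* R[i] declared as a numClosedFieldType: this is what gives 'M[Cplx R]_d its
   canonical normed topology. *)
Definition Cplx (R : realType) : numClosedFieldType := R[i].

Definition of_real (R : realType) (x : R) : Cplx R := (x%:C)%C.

(* 2 ^ n, in a form whose successor case is definitionally 2 * _, as the
   Kronecker product of matrix dimensions requires. *)
Fixpoint qdim (n : nat) : nat := if n is m.+1 then (2 * qdim m)%N else 1%N.

Lemma qdimE n : qdim n = (2 ^ n)%N.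
Proof. by elim: n => //= n ->; rewrite expnS. Qed.

Notation ket R n := 'cV[Cplx R]_(qdim n).
Notation oper R n := 'M[Cplx R]_(qdim n).

Inductive pauli1 := PI | PX | PY | PZ.

Definition pauli1_code (p : pauli1) : bool * bool :=
  match p with
  | PI => (false, false) | PX => (true, false)
  | PY => (true, true) | PZ => (false, true)
  end.

Definition pauli1_decode (c : bool * bool) : pauli1 :=
  match c with
  | (false, false) => PI | (true, false) => PX
  | (true, true) => PY | (false, true) => PZ
  end.

Lemma pauli1_codeK : cancel pauli1_code pauli1_decode.
Proof. by case. Qed.

HB.instance Definition _ := Finite.copy pauli1 (can_type pauli1_codeK).

Definition pauli1_mx (R : realType) (p : pauli1) : 'M[Cplx R]_2 :=
  \matrix_(i, j)
    match p with
    | PI => (i == j)%:R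
    | PX => (i != j)%:R
    | PY => if i == j then 0 else if i == 0 then - 'i else 'i
    | PZ => if i == j then (-1) ^+ i else 0
    end.

(* s 0 (x) s 1 (x) ... (x) s (n - 1) *)
Fixpoint string_op (R : realType) (n : nat) : ('I_n -> pauli1) -> oper R n :=
  match n with
  | 0 => fun=> 1%:M
  | m.+1 => fun s =>
      tensmx (pauli1_mx R (s ord0)) (string_op R (fun k : 'I_m => s (lift ord0 k)))
  end.

(* The Boolean is the sign: true stands for -1. *)
Definition pauli (n : nat) : finType := (bool * {ffun 'I_n -> pauli1})%type.

Definition pauli_op (R : realType) n (P : pauli n) : oper R n :=
  (-1) ^+ P.1 *: string_op R P.2.

(* Excludes both I and -I. *)
Definition nonidentity n (P : pauli n) : bool := P.2 != [ffun=> PI].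

Definition commutator (R : realType) d (A B : 'M[Cplx R]_d) : 'M[Cplx R]_d :=
  A *m B - B *m A.

Definition anticommutator (R : realType) d (A B : 'M[Cplx R]_d) : 'M[Cplx R]_d :=
  A *m B + B *m A.

Definition unit_ket (R : realType) n (psi : ket R n) : Prop :=
  psi ^t* *m psi = 1%:M.

Definition density (R : realType) n (psi : ket R n) : oper R n := psi *m psi ^t*.

(* The unique (up to a scalar) joint +1 eigenvector of a set of signed Paulis. *)
Definition stabilizer_state (R : realType) n (psi : ket R n) : Prop :=
  unit_ket psi /\
  exists S : {set pauli n},
    (forall P, P \in S -> pauli_op R P *m psi = psi) /\
    (forall phi : ket R n, (forall P, P \in S -> pauli_op R P *m phi = phi) ->
       exists c : Cplx R, phi = c *: psi).

Definition detector (R : realType) n (psi : ket R n) (P : pauli n) : Prop :=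
  psi ^t* *m pauli_op R P *m psi = 1%:M.

Definition pauli_prod (R : realType) n (T : {set pauli n}) : oper R n :=
  \big[mulmx/1%:M]_(P in T) pauli_op R P.

(* Paulis square to I, so multiplicative independence only involves products
   over subsets; their order is irrelevant as the detectors commute. *)
Definition detector_set (R : realType) n (psi : ket R n) (DD : {set pauli n}) : Prop :=
  [/\ forall P, P \in DD -> detector psi P,
      forall P Q, P \in DD -> Q \in DD -> comm_mx (pauli_op R P) (pauli_op R Q)
    & forall T : {set pauli n}, T \subset DD -> T != finset.set0 ->
        pauli_prod R T <> 1%:M].

Definition history_proj (R : realType) n (DD S : {set pauli n}) : oper R n :=
  (\big[mulmx/1%:M]_(P in S) (2^-1 *: (1%:M - pauli_op R P))) *m
  (\big[mulmx/1%:M]_(P in DD :\: S) (2^-1 *: (1%:M + pauli_op R P))).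

Definition history_prob (R : realType) n (DD : {set pauli n}) (X : oper R n)
    (S : {set pauli n}) : Cplx R :=
  \tr (history_proj R DD S *m X).

Inductive eeg (n : nat) :=
  | EEG_H of pauli n
  | EEG_S of pauli n
  | EEG_C of pauli n & pauli n
  | EEG_A of pauli n & pauli n.

Definition eeg_indices n (g : eeg n) : seq (pauli n) :=
  match g with
  | EEG_H P | EEG_S P => [:: P]
  | EEG_C P Q | EEG_A P Q => [:: P; Q]
  end.

Definition eeg_wf n (g : eeg n) : bool :=
  all (@nonidentity n) (eeg_indices g) && uniq (eeg_indices g).

Definition eeg_map (R : realType) n (g : eeg n) (rho : oper R n) : oper R n :=
  match g with
  | EEG_H P => - 'i *: commutator (pauli_op R P) rho
  | EEG_S P => pauli_op R P *m rho *m pauli_op R P - rho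
  | EEG_C P Q =>
      let p := pauli_op R P in let q := pauli_op R Q in
      p *m rho *m q + q *m rho *m p
      - 2^-1 *: anticommutator (anticommutator p q) rho
  | EEG_A P Q =>
      let p := pauli_op R P in let q := pauli_op R Q in
      'i *: (p *m rho *m q - q *m rho *m p
             + 2^-1 *: anticommutator (commutator p q) rho)
  end.

Definition flipped (R : realType) n (DD : {set pauli n}) (Q : pauli n) : {set pauli n} :=
  [set P in DD | commutator (pauli_op R P) (pauli_op R Q) != 0]%SET.

Definition event_class (R : realType) n (DD D : {set pauli n}) (g : eeg n) : Prop :=
  eeg_wf g /\ forall P, P \in eeg_indices g -> flipped R DD P = D.

Definition error_generator_in (R : realType) n (K : eeg n -> Prop)
    (G : oper R n -> oper R n) : Prop :=
  exists (m : nat) (c : 'I_m -> R) (g : 'I_m -> eeg n),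
    (forall k, K (g k)) /\
    (forall rho, G rho = \sum_(k < m) of_real (c k) *: eeg_map (g k) rho).

(* exp(G) rho = \sum_k G^k rho / k!, as the limit of the partial sums *)
Definition super_exp (R : realType) n (G : oper R n -> oper R n) (rho : oper R n) :
    oper R n :=
  limn (series (fun k : nat => (k`!%:R : Cplx R)^-1 *: iter k G rho)).

(* Rates are arbitrary reals: the exponential of a real combination of elementary
   error generators need not be positive, so they may fall outside [0, 1]. *)
Record dem (R : realType) (T : finType) := DEM {
  dem_size : nat;
  dem_event : 'I_dem_size -> {set T};
  dem_rate : 'I_dem_size -> R
}.

Definition dem_history (R : realType) (T : finType) (M : dem R T)
    (J : {set 'I_(dem_size M)}) : {set T} :=
  [set x | odd #|[set i in J | x \in dem_event i]%SET|]%SET.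

Definition dem_prob (R : realType) (T : finType) (M : dem R T) (S : {set T}) : R :=
  \sum_(J : {set 'I_(dem_size M)} | dem_history J == S)
    (\prod_(i in J) dem_rate i) * (\prod_(i in ~: J) (1 - dem_rate i)).

Definition single_event_dem (R : realType) (T : finType) (D : {set T}) (p : R) : dem R T :=
  @DEM R T 1 (fun=> D) (fun=> p).

Definition perfectly_models (R : realType) n (DD : {set pauli n})
    (M : dem R (pauli n)) (X : oper R n) : Prop :=
  forall S : {set pauli n}, S \subset DD ->
    history_prob DD X S = of_real (dem_prob M S).

(* Main.v *)
Require Import Defs.
From HB Require Import structures.
From mathcomp Require Import all_boot all_order all_algebra.
From mathcomp Require Import all_classical all_reals all_analysis.
From mathcomp Require Import complex.
From mathcomp Require Import spectral mxtens.

(* Left multiplication by an operator Z that commutes with every Pauli index of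
   the generator G commutes with G, hence with exp(G).  A detector outside D is
   such a Z, and so is a product of two detectors of D, because each of them
   anticommutes with every index.  Since all these Z fix |psi><psi|, they fix
   X = exp(G)[|psi><psi|]: detectors outside D act trivially on X and those of D
   all act in the same way, as P0 say.  Hence X = (X + P0 X)/2 + (X - P0 X)/2 is
   a sum of joint left eigenoperators of all detectors, of syndromes set0 and D,
   and the history projectors pick out one of the two terms.  The probabilities
   follow from tr X = 1, and they are real because X is Hermitian. *)

Set Implicit Arguments.
Unset Strict Implicit.
Unset Printing Implicit Defensive.

Import Order.TTheory GRing.Theory Num.Theory.
Import numFieldNormedType.Exports.

Local Open Scope ring_scope.
Local Open Scope sesquilinear_scope.

(** * Kronecker products and adjoints *)

Lemma tens1mx (K : comPzRingType) m n : (1%:M : 'M[K]_m) *t (1%:M : 'M[K]_n) = 1%:M.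
Proof.
apply/matrixP=> i j; case: (mxtens_indexP i) => i1 i2; case: (mxtens_indexP j) => j1 j2.
rewrite tensmxE !mxE -natrM mulnb (can_eq (@mxtens_indexK _ _)).
by rewrite -[(i1, i2) == _]/((_ == _) && (_ == _)).
Qed.

Lemma tensmxZ (K : comPzRingType) m n p q (a b : K) (A : 'M[K]_(m, n)) (B : 'M[K]_(p, q)) :
  (a *: A) *t (b *: B) = (a * b) *: (A *t B).
Proof.
apply/matrixP=> i j; case: (mxtens_indexP i) => i1 i2; case: (mxtens_indexP j) => j1 j2.
by rewrite !(tensmxE, mxE) mulrACA.
Qed.

Lemma adjointM (C : numClosedFieldType) m n p (A : 'M[C]_(m, n)) (B : 'M[C]_(n, p)) :
  (A *m B)^t* = B^t* *m A^t*.
Proof. by rewrite trmx_mul map_mxM. Qed.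

Lemma adjointZ (C : numClosedFieldType) m n (a : C) (A : 'M[C]_(m, n)) :
  (a *: A)^t* = a^* *: A^t*.
Proof. by rewrite linearZ map_mxZ. Qed.

Lemma adjoint_tens (C : numClosedFieldType) m n p q (A : 'M[C]_(m, n)) (B : 'M[C]_(p, q)) :
  (A *t B)^t* = A^t* *t B^t*.
Proof. by rewrite trmx_tens map_mxT. Qed.

(** * Pauli operators: self-adjoint involutions that pairwise commute or anticommute *)

Section PauliOperators.
Variable R : realType.

Lemma pauli1_mx_sqr (p : pauli1) : pauli1_mx R p *m pauli1_mx R p = 1%:M.
Proof.
apply/matrixP=> i j; rewrite !mxE !big_ord_recl big_ord0 addr0 !mxE.
have i2 : 'i * 'i = -1 :> Cplx R by rewrite -expr2 sqrCi.
by case: p; case: i => [[|[|]]] //= hi; case: j => [[|[|]]] //= hj;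
  rewrite ?(mulr0, mul0r, mulr1, mul1r, addr0, add0r, mulrN, mulNr, i2, opprK, mulrNN).
Qed.

Lemma pauli1_mx_adjoint (p : pauli1) : (pauli1_mx R p)^t* = pauli1_mx R p.
Proof.
apply/matrixP=> i j; rewrite !mxE.
by case: p; case: i => [[|[|]]] //= hi; case: j => [[|[|]]] //= hj;
  rewrite ?(conjC1, conjC0, rmorphN, rmorphXn, conjCi, opprK) //=
    ?(conjC1, conjC0, rmorphN, rmorphXn, conjCi, opprK).
Qed.

Lemma pauli1_mx_comm (p q : pauli1) : exists b : bool,
  pauli1_mx R p *m pauli1_mx R q = (-1) ^+ b *: (pauli1_mx R q *m pauli1_mx R p).
Proof.
(* Two single-qubit Paulis anticommute exactly when they are distinct and neither is the
   identity. *)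
exists [&& p != PI, q != PI & p != q].
apply/matrixP=> i j; rewrite !mxE !big_ord_recl !big_ord0 !addr0 !mxE.
by case: p; case: q; case: i => [[|[|]]] //= hi; case: j => [[|[|]]] //= hj;
  rewrite ?(mulr0, mul0r, mulr1, mul1r, addr0, add0r, mulrN, mulNr, opprK, mulrNN, expr0, expr1)
    ?oppr0 //.
Qed.

Lemma string_op_sqr n (s : 'I_n -> pauli1) : string_op R s *m string_op R s = 1%:M.
Proof.
elim: n s => [|n IH] s /=; first by rewrite mulmx1.
by rewrite tensmx_mul pauli1_mx_sqr IH tens1mx.
Qed.

Lemma string_op_adjoint n (s : 'I_n -> pauli1) : (string_op R s)^t* = string_op R s.
Proof.
elim: n s => [|n IH] s /=; first by rewrite trmx1 map_mx1.
by rewrite adjoint_tens pauli1_mx_adjoint IH.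
Qed.

(** Signs multiply across the tensor factors, so the sign bits combine by exclusive or. *)
Lemma string_op_comm n (s t : 'I_n -> pauli1) : exists b : bool,
  string_op R s *m string_op R t = (-1) ^+ b *: (string_op R t *m string_op R s).
Proof.
elim: n s t => [|n IH] s t /=; first by exists false; rewrite expr0 scale1r.
have [b eb] := pauli1_mx_comm (s ord0) (t ord0).
have [c ec] := IH (fun k => s (lift ord0 k)) (fun k => t (lift ord0 k)).
exists (b (+) c).
by rewrite !tensmx_mul eb ec tensmxZ signr_addb.
Qed.

Lemma pauli_op_sqr n (P : pauli n) : pauli_op R P *m pauli_op R P = 1%:M.
Proof.
by rewrite /pauli_op -scalemxAl -scalemxAr scalerA -expr2 sqrr_sign scale1r string_op_sqr.
Qed.

Lemma pauli_op_adjoint n (P : pauli n) : (pauli_op R P)^t* = pauli_op R P.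
Proof. by rewrite /pauli_op adjointZ string_op_adjoint rmorph_sign. Qed.

Lemma pauli_op_comm n (P Q : pauli n) : exists b : bool,
  pauli_op R P *m pauli_op R Q = (-1) ^+ b *: (pauli_op R Q *m pauli_op R P).
Proof.
have [b eb] := string_op_comm P.2 Q.2; exists b.
rewrite /pauli_op -!scalemxAl -!scalemxAr eb !scalerA; congr (_ *: _).
by rewrite mulrC -mulrA; congr (_ * _); rewrite mulrC.
Qed.

(** The sign in [pauli_op_comm] can only be +1 or -1, and +1 would make the commutator vanish. *)
Lemma pauli_op_anticomm n (P Q : pauli n) :
  commutator (pauli_op R P) (pauli_op R Q) != 0 ->
  pauli_op R P *m pauli_op R Q = - (pauli_op R Q *m pauli_op R P).
Proof.
rewrite /commutator; have [[] ->] := pauli_op_comm P Q; first by rewrite expr1 scaleN1r.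
by rewrite expr0 scale1r subrr eqxx.
Qed.

End PauliOperators.

(** * Linearity, commutation, trace and adjoint of elementary error generators *)

Section ElementaryErrorGenerators.
Variables (R : realType) (n : nat).
Implicit Types (g : eeg n) (P Q : pauli n) (X Y Z : oper R n).

Lemma eeg_map_linear g (a : Cplx R) X Y :
  eeg_map g (a *: X + Y) = a *: eeg_map g X + eeg_map g Y.
Proof.
case: g => [P|P|P Q|P Q]; rewrite /eeg_map /commutator /anticommutator /=;
  move: (pauli_op R P) => p; try (move: (pauli_op R Q) => q).
(* Each map is rebuilt from left and right multiplications, [mulmx] and [mulmxr], so that its
   linearity is inferred structurally. *)
- exact: (linearP (- 'i \*: (mulmx p \- mulmxr p))).
- exact: (linearP ((mulmxr p \o mulmx p) \- idfun)).
- move: (p *m q + q *m p) => m.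
  exact: (linearP ((mulmxr q \o mulmx p) \+ (mulmxr p \o mulmx q)
    \- (2^-1 \*: (mulmx m \+ mulmxr m)))).
- move: (p *m q - q *m p) => m.
  exact: (linearP ('i \*: ((mulmxr q \o mulmx p) \- (mulmxr p \o mulmx q)
    \+ (2^-1 \*: (mulmx m \+ mulmxr m))))).
Qed.

(** In every term the indices multiply [X] from the left or the right: [Z] passes the left factors
    by commutation and leaves the right ones untouched. *)
Lemma eeg_map_mull g Z X :
  (forall P, P \in eeg_indices g -> Z *m pauli_op R P = pauli_op R P *m Z) ->
  Z *m eeg_map g X = eeg_map g (Z *m X).
Proof.
move=> hZ; have comm P : P \in eeg_indices g ->
    forall M : oper R n, Z *m (pauli_op R P *m M) = pauli_op R P *m (Z *m M).
  by move=> Pg M; rewrite !mulmxA hZ.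
case: g comm {hZ} => [P|P|P Q|P Q] comm; rewrite /eeg_map /commutator /anticommutator /=;
  have := comm P (mem_head _ _);
  try (have : forall M : oper R n, Z *m (pauli_op R Q *m M) = pauli_op R Q *m (Z *m M)
    by [apply: comm; rewrite !inE eqxx orbT]);
  move: (pauli_op R P) => p; try move: (pauli_op R Q) => q; move=> c1; try move=> c2.
- by rewrite -scalemxAr mulmxBr -!mulmxA c1.
- by rewrite mulmxBr -!mulmxA c1.
- have : forall M : oper R n, Z *m ((p *m q + q *m p) *m M) = (p *m q + q *m p) *m (Z *m M).
    by move=> M; rewrite !mulmxDl mulmxDr -!mulmxA !(c1, c2).
  move: (p *m q + q *m p) => m c3.
  by rewrite mulmxBr mulmxDr -scalemxAr mulmxDr -!mulmxA !(c1, c2, c3).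
- have : forall M : oper R n, Z *m ((p *m q - q *m p) *m M) = (p *m q - q *m p) *m (Z *m M).
    by move=> M; rewrite !mulmxBl mulmxBr -!mulmxA !(c1, c2).
  move: (p *m q - q *m p) => m c3.
  by rewrite -scalemxAr mulmxDr mulmxBr -scalemxAr mulmxDr -!mulmxA !(c1, c2, c3).
Qed.

(** Infinitesimal trace preservation. Cyclicity turns each sandwich term into the trace of a product
    of indices times [X]; an anticommutator with [X] doubles under the trace, which its factor 1/2
    undoes, and everything cancels. *)
Lemma mxtrace_eeg_map g X : \tr (eeg_map g X) = 0.
Proof.
have cyc3 (A B C : oper R n) : \tr (A *m B *m C) = \tr (C *m A *m B).
  by rewrite mxtrace_mulC mulmxA.
have half (t : Cplx R) : 2^-1 * (t + t) = t.
  by rewrite -mulr2n -[t *+ 2]mulr_natl mulKf // pnatr_eq0.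
case: g => [P|P|P Q|P Q]; rewrite /eeg_map /commutator /anticommutator /=;
  have := pauli_op_sqr R P; move: (pauli_op R P) => p pp; try move: (pauli_op R Q) => q.
- by rewrite mxtraceZ raddfB /= mxtrace_mulC subrr mulr0.
- by rewrite raddfB /= cyc3 pp mul1mx subrr.
- rewrite raddfB /= mxtraceD mxtraceZ mxtraceD (mxtrace_mulC X) half.
  by rewrite (cyc3 p X) (cyc3 q X) mulmxDl mxtraceD [X in X - _]addrC subrr.
- rewrite mxtraceZ mxtraceD raddfB /= mxtraceZ mxtraceD (mxtrace_mulC X) half.
  by rewrite (cyc3 p X) (cyc3 q X) mulmxBl raddfB /= [_ - _ + _]addrC subrKA subrr mulr0.
Qed.

(** Taking adjoints reverses products. This negates the antisymmetric expressions in the H and A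
    cases, and conjugating their factor ['i] restores the sign; the S and C expressions are
    symmetric. *)
Lemma adjoint_eeg_map g X : (eeg_map g X)^t* = eeg_map g (X^t*).
Proof.
have adjD (A B : oper R n) : (A + B)^t* = A^t* + B^t* by rewrite linearD map_mxD.
have adjB (A B : oper R n) : (A - B)^t* = A^t* - B^t* by rewrite linearB map_mxB.
have half : (2^-1)^* = 2^-1 :> Cplx R by rewrite conj_Creal // realV realn.
have iC : 'i^* = - 'i :> Cplx R by rewrite conjCi.
case: g => [P|P|P Q|P Q]; rewrite /eeg_map /commutator /anticommutator /=;
  have := pauli_op_adjoint R P; move: (pauli_op R P) => p hp;
  try (have := pauli_op_adjoint R Q; move: (pauli_op R Q) => q hq).
- by rewrite adjointZ adjB !adjointM hp rmorphN /= iC opprK scaleNr -scalerN opprB.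
- by rewrite adjB !adjointM hp mulmxA.
- rewrite adjB adjD adjointZ adjD !adjointM adjD !adjointM hp hq half !mulmxA.
  by rewrite [X in X - _]addrC [q *m p + _]addrC [_ *m X^t* + _]addrC.
- rewrite adjointZ adjD adjB adjointZ adjD !adjointM adjB !adjointM hp hq half iC !mulmxA.
  rewrite -[q *m p - _]opprB mulmxN mulNmx -opprD scalerN scaleNr -scalerN opprD opprB opprK.
  by rewrite [_ *m X^t* + _]addrC.
Qed.

End ElementaryErrorGenerators.

(** * Detectors, detection histories and the single-event model *)

Lemma mulmx_self_eq0 (C : numClosedFieldType) m (v : 'cV[C]_m) : v^t* *m v = 0 -> v = 0.
Proof.
move/matrixP/(_ 0 0); rewrite !mxE => v0; apply/matrixP=> i j; rewrite ord1 mxE.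
have /psumr_eq0P : forall k : 'I_m, true -> 0 <= `|v k 0| ^+ 2.
  by move=> k _; rewrite exprn_ge0.
have -> : \sum_(k | true) `|v k 0| ^+ 2 = 0.
  by rewrite -[RHS]v0; apply: eq_bigr => k _; rewrite !mxE normCK mulrC.
by move=> /(_ erefl i isT)/eqP; rewrite sqrf_eq0 normr_eq0 => /eqP.
Qed.

(** Used for products of projectors: the eigenvalues are 0 or 1, so their product is a
    conjunction. *)
Lemma big_mulmx_eigen (K : comPzRingType) d m (I : finType) (A : {set I})
    (F : I -> 'M[K]_d) (b : I -> bool) (Y : 'M[K]_(d, m)) :
  (forall i, i \in A -> F i *m Y = (b i)%:R *: Y) ->
  (\big[mulmx/1%:M]_(i in A) F i) *m Y = [forall (i | i \in A), b i]%:R *: Y.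
Proof.
move=> FY; rewrite -big_andE.
elim/big_rec2: _ => [|i c Z iA IH]; first by rewrite mul1mx scale1r.
by rewrite -mulmxA IH -scalemxAr FY // scalerA mulrC -natrM mulnb.
Qed.

Section Detection.
Variables (R : realType) (n : nat).
Implicit Types (P Q : pauli n) (DD D S : {set pauli n}) (X : oper R n).

(** Since $P$ is a Hermitian involution, the squared norm of $P\psi-\psi$ is
    $2-2\langle\psi|P|\psi\rangle=0$. *)
Lemma detector_stabilizes (psi : ket R n) P :
  unit_ket psi -> detector psi P -> pauli_op R P *m psi = psi.
Proof.
rewrite /unit_ket /detector => psi1 Ppsi; apply/eqP; rewrite -subr_eq0; apply/eqP.
apply: mulmx_self_eq0.
have -> : (pauli_op R P *m psi - psi)^t* = psi^t* *m pauli_op R P - psi^t*.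
  by rewrite linearB map_mxB -[map_mx _ (pauli_op R P *m psi)^T]/((pauli_op R P *m psi)^t*)
    adjointM pauli_op_adjoint.
rewrite mulmxBl !mulmxBr psi1 Ppsi !mulmxA Ppsi -[_ *m _ *m pauli_op R P]mulmxA.
by rewrite pauli_op_sqr mulmx1 psi1 !subrr.
Qed.

Lemma history_prob_decomp DD D P0 X S :
  D \subset DD -> P0 \in D -> S \subset DD ->
  (forall P, P \in DD -> comm_mx (pauli_op R P) (pauli_op R P0)) ->
  (forall P, P \in DD -> P \notin D -> pauli_op R P *m X = X) ->
  (forall P Q, P \in D -> Q \in D -> pauli_op R P *m (pauli_op R Q *m X) = X) ->
  history_prob DD X S =
    (S == finset.set0)%:R * (2^-1 * (\tr X + \tr (pauli_op R P0 *m X))) +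
    (S == D)%:R * (2^-1 * (\tr X - \tr (pauli_op R P0 *m X))).
Proof.
move=> DDD P0D SDD commP0 fixX pairX.
set Z := pauli_op R P0 *m X.
have PZ P : P \in DD -> P \notin D -> pauli_op R P *m Z = Z.
  by move=> PDD PD; rewrite /Z mulmxA commP0 // -mulmxA fixX.
have PX P : P \in D -> pauli_op R P *m X = Z.
  (* With $X = P_0PX$ one gets $PX = PP_0PX = P_0PPX = P_0X$. *)
  move=> PD; rewrite -{1}(pairX _ _ P0D PD) -/Z !mulmxA.
  rewrite commP0 ?(fintype.subsetP DDD) // -[_ *m _ *m pauli_op R P]mulmxA.
  by rewrite pauli_op_sqr mulmx1.
pose Xp := 2^-1 *: (X + Z); pose Xm := 2^-1 *: (X - Z).
have half (V : oper R n) : 2^-1 *: (V + V) = V.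
  by rewrite -mulr2n -[V *+ 2]scaler_nat scalerA mulVf ?pnatr_eq0 // scale1r.
have eX : X = Xp + Xm by rewrite -scalerDr addrACA subrr addr0 half.
have PXp P : P \in DD -> pauli_op R P *m Xp = Xp.
  move=> PDD; rewrite -scalemxAr mulmxDr; have [PD|PD] := boolP (P \in D).
    by rewrite pairX // PX // addrC.
  by rewrite PZ // fixX.
have PXm P : P \in DD -> pauli_op R P *m Xm = if P \in D then - Xm else Xm.
  move=> PDD; rewrite -scalemxAr mulmxBr; case: ifPn => PD.
    by rewrite pairX // PX // -scalerN opprB.
  by rewrite PZ // fixX.
(* The factor for outcome $(-1)^e$ is the spectral projector of $P$, so it keeps an eigenoperator of
   eigenvalue $(-1)^b$ if $e=b$ and kills it otherwise. *)
have projE (e : bool) (P : pauli n) (V : oper R n) (b : bool) :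
    pauli_op R P *m V = (-1) ^+ b *: V ->
    (2^-1 *: (1%:M + (-1) ^+ e *: pauli_op R P)) *m V = (e == b)%:R *: V.
  move: (pauli_op R P) => M PV; rewrite -scalemxAl mulmxDl mul1mx -scalemxAl PV scalerA -signr_addb.
  case: e b {PV} => [] [] /=; rewrite ?expr0 ?expr1 ?scale1r ?scaleN1r ?subrr ?half //;
    by rewrite scaler0 scale0r.
have minusE P : 1%:M - pauli_op R P = 1%:M + (-1) ^+ true *: pauli_op R P.
  by rewrite expr1 scaleN1r.
have plusE P : 1%:M + pauli_op R P = 1%:M + (-1) ^+ false *: pauli_op R P.
  by rewrite expr0 scale1r.
have inDD P : P \in S -> P \in DD by apply: (fintype.subsetP SDD).
(* All detectors act as +1 on [Xp]: the factors over [DD :\: S] do nothing, and a single factor over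
   [S] would annihilate it. *)
have hXp : history_proj R DD S *m Xp = (S == finset.set0)%:R *: Xp.
  rewrite /history_proj -mulmxA (@big_mulmx_eigen _ _ _ _ (DD :\: S) _ xpredT); last first.
    move=> P; rewrite finset.inE => /andP[_ PDD]; rewrite plusE (projE _ _ _ false) //.
    by rewrite scale1r PXp.
  have -> : [forall (P | P \in DD :\: S), xpredT P] = true by apply/forall_inP.
  rewrite scale1r.
  rewrite (@big_mulmx_eigen _ _ _ _ S _ xpred0); last first.
    move=> P PS; rewrite minusE (projE _ _ _ false) //.
    by rewrite scale1r PXp ?inDD.
  congr ((nat_of_bool _)%:R *: _); apply/forall_inP/eqP => [S0|-> P].
    by apply/finset.setP => P; rewrite finset.inE; apply/negP => /S0.
  by rewrite finset.inE.
(* [Xm] survives the factors over [S] iff [S] lies in [D], and those over [DD :\: S] iff [D] lies in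
   [S]. *)
have hXm : history_proj R DD S *m Xm = (S == D)%:R *: Xm.
  have PXm' P : P \in DD -> pauli_op R P *m Xm = (-1) ^+ (P \in D) *: Xm.
    by move=> /PXm ->; case: ifP => _; rewrite ?expr1 ?expr0 ?scaleN1r ?scale1r.
  rewrite /history_proj -mulmxA
    (@big_mulmx_eigen _ _ _ _ (DD :\: S) _ (fun P => P \notin D)); last first.
    move=> P; rewrite finset.inE => /andP[_ PDD]; rewrite plusE (projE _ _ _ (P \in D)) ?PXm' //.
  rewrite -scalemxAr (@big_mulmx_eigen _ _ _ _ S _ (fun P => P \in D)); last first.
    by move=> P PS; rewrite minusE (projE _ _ _ (P \in D)) ?PXm' ?inDD.
  rewrite scalerA -natrM mulnb; congr ((nat_of_bool _)%:R *: _).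
  apply/andP/eqP => [[/forall_inP h1 /forall_inP h2]|->].
    apply/eqP; rewrite finset.eqEsubset; apply/andP; split.
      by apply/fintype.subsetP.
    apply/fintype.subsetP => P PD; apply: contraT => PS.
    by have := h1 P; rewrite finset.inE PS (fintype.subsetP DDD) // PD => /(_ isT).
  split; apply/forall_inP => // P; rewrite finset.inE => /andP[] //.
rewrite /history_prob {1}eX mulmxDr hXp hXm mxtraceD !mxtraceZ !mxtraceD.
by rewrite raddfN.
Qed.

(** The only sets of occurring events are [set0] and the full set of ['I_1], with histories [set0]
    and [D]. The two terms are added, so the formula also covers empty [D]. *)
Lemma dem_prob_single (T : finType) (D S : {set T}) (p : R) :
  dem_prob (single_event_dem D p) S =
  (S == finset.set0)%:R * (1 - p) + (S == D)%:R * p.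
Proof.
have hist0 : dem_history (M := single_event_dem D p) finset.set0 = finset.set0.
  apply/finset.setP => x; rewrite !finset.inE.
  rewrite (_ : finset _ = finset.set0) ?cards0 //.
  by apply/finset.setP => i; rewrite !finset.inE.
have histT : dem_history (M := single_event_dem D p) finset.setT = D.
  apply/finset.setP => x; rewrite !finset.inE /=; have [xD|xD] := boolP (x \in D).
    rewrite (_ : finset _ = finset.setT) ?cardsT ?card_ord //.
    by apply/finset.setP => i; rewrite !finset.inE.
  rewrite (_ : finset _ = finset.set0) ?cards0 //.
  by apply/finset.setP => i; rewrite !finset.inE.
have T0 : [set: 'I_1]%SET != finset.set0 by rewrite -card_gt0 cardsT card_ord.
rewrite /dem_prob big_mkcond (bigD1 finset.set0) //= (bigD1 [set: 'I_1]%SET) //=.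
rewrite [X in _ + (_ + X)]big1; last first.
  move=> J /andP[/= J0 JT].
  case/set0Pn: J0 => i iJ; case/negP: JT; apply/eqP/finset.setP => j.
  by rewrite ord1 in iJ; rewrite ord1 iJ finset.inE.
rewrite hist0 histT addr0 ![_ == S]eq_sym; congr (_ + _).
  case: ifP => _; rewrite ?mul0r // big_set0 finset.setC0 mul1r.
  by rewrite (eq_bigl xpredT) ?big_ord1 ?mul1r // => i; rewrite finset.inE.
case: ifP => _; rewrite ?mul0r // finset.setCT big_set0 mulr1.
by rewrite (eq_bigl xpredT) ?big_ord1 ?mul1r // => i; rewrite finset.inE.
Qed.

End Detection.

(** * Convergence of matrix sequences and continuity of linear maps *)

Section MatrixConvergence.
Local Open Scope classical_set_scope.
Variable K : numFieldType.

(** Matrix balls are entrywise, and finitely many eventual conditions hold eventually together. *)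
Lemma cvg_mx_coord m n (F : nat -> 'M[K]_(m, n)) (M : 'M[K]_(m, n)) :
  (forall i j, F k i j @[k --> \oo] --> M i j) -> F k @[k --> \oo] --> M.
Proof.
move=> FM; apply/cvg_ballP => e e0.
suff : \forall k \near \oo, forall i j, ball (M i j) e (F k i j).
  by apply: filterS => k Hk; split.
by do 2!apply: filter_forall => ?; exact: (cvg_ball (FM _ _)).
Qed.

Lemma le_mx_norm m n (M : 'M[K]_(m, n)) i j : `|M i j| <= `|M|.
Proof.
rewrite [leRHS]/Num.norm /= mx_normE -[leLHS]nngE num_le.
exact: (le_bigmax _ (fun ij : 'I_m * 'I_n => `|M ij.1 ij.2|%:nng) (i, j)).
Qed.

Lemma cvg_coord m n (F : nat -> 'M[K]_(m, n)) (M : 'M[K]_(m, n)) i j :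
  F k @[k --> \oo] --> M -> F k i j @[k --> \oo] --> M i j.
Proof.
move=> /cvgrPdist_lt FM; apply/cvgrPdist_lt => e /FM; apply: filterS => k.
by apply: le_lt_trans; have := le_mx_norm (M - F k) i j; rewrite !mxE.
Qed.

Lemma linear_mx_bounded m n (V : normedModType K) (f : {linear 'M[K]_(m, n) -> V}) :
  exists2 C : K, 0 <= C & forall M, `|f M| <= C * `|M|.
Proof.
(* Expanding [M] in the matrix units bounds the image by their images, each coefficient being at
   most the max norm of [M]. *)
exists (\sum_(i < m) \sum_(j < n) `|f (delta_mx i j)|).
  by apply: sumr_ge0 => i _; apply: sumr_ge0.
move=> M; rewrite {1}(matrix_sum_delta M) linear_sum mulr_suml.
apply: le_trans (ler_norm_sum _ _ _) _; apply: ler_sum => i _.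
rewrite linear_sum mulr_suml.
apply: le_trans (ler_norm_sum _ _ _) _; apply: ler_sum => j _.
by rewrite linearZ /= normrZ mulrC ler_wpM2l // le_mx_norm.
Qed.

Lemma cvg_linear_mx m n (V : normedModType K) (f : {linear 'M[K]_(m, n) -> V})
    (F : nat -> 'M[K]_(m, n)) (M : 'M[K]_(m, n)) :
  F k @[k --> \oo] --> M -> f (F k) @[k --> \oo] --> f M.
Proof.
move=> FM; have [C C0 fC] := linear_mx_bounded f.
apply/cvgrPdist_lt => e e0; near=> k.
rewrite -linearB; apply: le_lt_trans (fC _) _.
(* [C] may be 0; [C + 1] is positive and can be divided by. *)
apply: (@le_lt_trans _ _ ((C + 1) * `|M - F k|)); first by rewrite ler_wpM2r // lerDl.
rewrite mulrC -ltr_pdivlMr ?ltr_wpDl //; near: k.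
by apply: cvgr_dist_lt => //; rewrite divr_gt0 ?ltr_wpDl.
Unshelve. all: by end_near. Qed.

End MatrixConvergence.

(** * Convergence of complex sequences and series *)

Section ComplexConvergence.
Local Open Scope classical_set_scope.
Variable R : realType.

Lemma cvg_of_real (a : R^nat) (l : R) :
  a k @[k --> \oo] --> l -> of_real (a k) @[k --> \oo] --> of_real l.
Proof.
move=> /cvgrPdist_lt al; apply/cvgrPdist_lt => e e0.
(* A positive element of [Cplx R] is real, so the tolerance comes from [R]. *)
have eE : e = of_real (complex.Re e) by rewrite /of_real RRe_real // gtr0_real.
have : 0 < complex.Re e by move: e0; rewrite ltcE => /andP[].
move=> /al; apply: filterS => k kl.
by rewrite eE /of_real -rmorphB /= normc_def /= expr0n addr0 sqrtr_sqr ltcR.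
Qed.

Lemma cvg_conj (u : nat -> Cplx R) (l : Cplx R) :
  u k @[k --> \oo] --> l -> (u k)^* @[k --> \oo] --> l^*.
Proof.
move=> /cvgrPdist_lt ul; apply/cvgrPdist_lt => e /ul; apply: filterS => k kl.
by rewrite -rmorphB norm_conjC.
Qed.

(** The real and imaginary parts are both dominated by [v], so they converge absolutely and can be
    recombined. *)
Lemma complex_series_le_cvg (u : nat -> Cplx R) (v : R^nat) :
  (forall k, `|u k| <= of_real (v k)) -> cvgn (series v) -> cvgn (series u).
Proof.
move=> uv cv; have {}uv k : `|u k : R[i]| <= (v k)%:C%C := uv k.
have dom (a : R^nat) : (forall k, `|a k| <= v k) -> cvgn (series a).
  move=> av; apply: normed_cvg; apply: (series_le_cvg _ _ _ cv) => k //=.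
  exact: le_trans (av k).
have cRe : cvgn (series (fun k => complex.Re (u k))).
  by apply: dom => k; rewrite -lecR; exact: le_trans (normc_ge_Re _) (uv k).
have cIm : cvgn (series (fun k => complex.Im (u k))).
  apply: dom => k; rewrite -lecR; apply: (le_trans _ (uv k)).
  (* Up to sign, the imaginary part of $u$ is the real part of $iu$, which has the same modulus. *)
  rewrite -normrN -ReiNIm; apply: le_trans (normc_ge_Re _) _.
  by rewrite normrM [X in _ * X]normc_def /= expr0n expr1n add0r sqrtr1 mulr1.
have -> : series u = (fun k => of_real (series (fun k => complex.Re (u k)) k) +
    'i%C * of_real (series (fun k => complex.Im (u k)) k)).
  apply/funext => k; rewrite /series /= /of_real !rmorph_sum mulr_sumr -big_split.
  by apply: eq_bigr => i _; exact: complexE.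
by apply: is_cvgD; [|apply: is_cvgMl_tmp]; apply/cvg_ex; eexists; apply: cvg_of_real; eassumption.
Qed.

End ComplexConvergence.

(** * The exponential of a linear map on operators *)

Section SuperExponential.
Local Open Scope classical_set_scope.
Variables (R : realType) (n : nat).
Variable G : {linear oper R n -> oper R n}.
Implicit Types (X Z : oper R n).

Let term X k : oper R n := (k`!%:R : Cplx R)^-1 *: iter k G X.

(** [limn] is a meaningful limit only for a convergent sequence. Here each entry is dominated by the
    exponential series, because the norm of $G^kX$ is at most $C^k$ times that of $X$. *)
Lemma super_exp_cvg X : series (term X) k @[k --> \oo] --> super_exp G X.
Proof.
suff : forall i j, cvgn (fun k => series (term X) k i j).
  move=> cX; pose L : oper R n := \matrix_(i, j) limn (fun k => series (term X) k i j).
  apply/cvg_ex; exists L; apply: cvg_mx_coord => i j; rewrite mxE; exact: cX.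
move=> i j; have [C C0 GC] := linear_mx_bounded G.
have -> : (fun k => series (term X) k i j) = series (fun k => term X k i j).
  by apply/funext => k; rewrite /series /= summxE.
have real0 (x : Cplx R) : 0 <= x -> of_real (complex.Re x) = x.
  by move=> x0; rewrite /of_real RRe_real // ger0_real.
(* [C] and the norm of [X] are nonnegative elements of [Cplx R]; taking real parts gives access to
   the real exponential series. *)
apply: (@complex_series_le_cvg _ _ (complex.Re `|X| *: exp_coeff (complex.Re C))).
  move=> k; rewrite mxE normrM normfV normr_nat.
  have iterle : `|iter k G X| <= C ^+ k * `|X|.
    elim: k => [|k IH] /=; first by rewrite mul1r.
    by apply: le_trans (GC _) _; rewrite exprS -mulrA ler_wpM2l.
  have -> : of_real ((complex.Re `|X| *: exp_coeff (complex.Re C)) k)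
      = k`!%:R^-1 * (C ^+ k * `|X|).
    rewrite -[in RHS](real0 C C0) -[in RHS](real0 `|X|) // /of_real /exp_coeff.
    rewrite -[(_ *: _) k]/(complex.Re `|X| * (complex.Re C ^+ k / k`!%:R)).
    rewrite !rmorphM /= fmorphV /= rmorphXn /= rmorph_nat.
    by rewrite mulrC [_ / _]mulrC -mulrA.
  rewrite ler_wpM2l ?invr_ge0 //; apply: le_trans iterle; exact: le_mx_norm.
apply: is_cvg_seriesZ; exact: is_cvg_series_exp_coeff.
Qed.

Let op_cvg_unique (u : nat -> oper R n) (L M : oper R n) :
  u k @[k --> \oo] --> L -> u k @[k --> \oo] --> M -> L = M.
Proof. by move=> uL uM; apply: cvg_unique uL uM; exact: norm_hausdorff. Qed.

(** [Z] fixes every term of the series, and left multiplication is continuous. *)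
Lemma mulmx_super_exp Z X :
  (forall Y, Z *m G Y = G (Z *m Y)) -> Z *m X = X ->
  Z *m super_exp G X = super_exp G X.
Proof.
move=> ZG ZX; have iterZ k : Z *m iter k G X = iter k G X.
  by elim: k => //= k IH; rewrite ZG IH.
apply: (@op_cvg_unique (series (term X))); last exact: super_exp_cvg.
have -> : series (term X) = fun k => Z *m series (term X) k.
  apply/funext => k; rewrite /series /= mulmx_sumr; apply: eq_bigr => i _.
  by rewrite -scalemxAr iterZ.
exact: (cvg_linear_mx (f := mulmx Z) (super_exp_cvg (X := X))).
Qed.

Lemma mxtrace_super_exp X :
  (forall Y, \tr (G Y) = 0) -> \tr (super_exp G X) = \tr X.
Proof.
move=> trG; have := cvg_linear_mx (f := @mxtrace (Cplx R) (qdim n) : {linear _ -> (Cplx R)^o})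
  (super_exp_cvg (X := X)).
(* The partial sum at index 0 is empty and has trace 0. From index 1 on it contains the term [X],
   the only one with a possibly nonzero trace, so the shifted sequence of traces is constant. *)
rewrite -cvg_shiftS /= => trE.
apply: (@cvg_unique (Cplx R) (@norm_hausdorff _ _) _ _ _ _ trE).
rewrite (_ : (fun k => _) = fun=> \tr X); first exact: cvg_cst.
apply/funext => k; rewrite /series /= big_nat_recl // raddfD raddf_sum /= big1 ?addr0.
  by rewrite /term fact0 invr1 scale1r.
by move=> i _; rewrite mxtraceZ trG mulr0.
Qed.

Lemma adjoint_super_exp X :
  (forall Y, (G Y)^t* = G (Y^t*)) -> X^t* = X ->
  (super_exp G X)^t* = super_exp G X.
Proof.
move=> Gadj Xadj; have iteradj k : (iter k G X)^t* = iter k G X.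
  by elim: k => //= k IH; rewrite Gadj IH.
apply: (@op_cvg_unique (series (term X))); last exact: super_exp_cvg.
(* The adjoint is only conjugate-linear, so its continuity is obtained entrywise from that of
   conjugation. *)
apply: cvg_mx_coord => i j; rewrite !mxE.
have -> : (fun k => series (term X) k i j) = fun k => (series (term X) k j i)^*.
  apply/funext => k; rewrite /series /= !summxE rmorph_sum; apply: eq_bigr => l _.
  by rewrite !mxE -{1}(iteradj l) !mxE rmorphM /= fmorphV rmorph_nat.
apply: cvg_conj; exact: cvg_coord (super_exp_cvg (X := X)).
Qed.

End SuperExponential.

(** * Error generators of an event class *)

(** Turns a proof of linearity into a bundled linear map equal to the given function, as the lemmas
    on [super_exp] require. *)
Lemma linear_pack (K : pzRingType) (U V : lmodType K) (f : U -> V) :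
  linear f -> exists g : {linear U -> V}, f = g.
Proof.
move=> lf.
pose g : {linear U -> V} := HB.pack f (GRing.isLinear.Build _ _ _ _ f lf).
by exists g.
Qed.

Section EventClass.
Variables (R : realType) (n : nat) (DD D : {set pauli n}).
Implicit Types (P Q : pauli n) (g : eeg n) (X Z : oper R n).

Lemma event_class_comm g P Q : event_class R DD D g ->
  Q \in eeg_indices g -> P \in DD -> P \notin D ->
  pauli_op R P *m pauli_op R Q = pauli_op R Q *m pauli_op R P.
Proof.
move=> [_ flip] /flip flipQ PDD; rewrite -flipQ finset.inE PDD /= negbK => /eqP.
exact: subr0_eq.
Qed.

Lemma event_class_anticomm g P Q : event_class R DD D g ->
  Q \in eeg_indices g -> P \in D ->
  pauli_op R P *m pauli_op R Q = - (pauli_op R Q *m pauli_op R P).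
Proof.
move=> [_ flip] /flip <-; rewrite finset.inE => /andP[_]; exact: pauli_op_anticomm.
Qed.

Lemma error_generator_linear (G : oper R n -> oper R n) (E : eeg n -> Prop) :
  error_generator_in E G -> linear G.
Proof.
move=> [m [c [g [_ GE]]]] a X Y; rewrite !GE scaler_sumr -big_split.
apply: eq_bigr => k _ /=.
by rewrite eeg_map_linear scalerDr !scalerA [a * _]mulrC.
Qed.

Lemma error_generator_mull (G : oper R n -> oper R n) Z X :
  error_generator_in (event_class R DD D) G ->
  (forall g Q, event_class R DD D g -> Q \in eeg_indices g ->
     Z *m pauli_op R Q = pauli_op R Q *m Z) ->
  Z *m G X = G (Z *m X).
Proof.
move=> [m [c [g [gD GE]]]] commZ; rewrite !GE mulmx_sumr; apply: eq_bigr => k _.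
by rewrite -scalemxAr eeg_map_mull // => Q; apply: commZ.
Qed.

Lemma error_generator_trace (G : oper R n -> oper R n) (E : eeg n -> Prop) X :
  error_generator_in E G -> \tr (G X) = 0.
Proof.
move=> [m [c [g [_ GE]]]]; rewrite GE raddf_sum /= big1 // => k _.
by rewrite mxtraceZ mxtrace_eeg_map mulr0.
Qed.

(** The coefficients are real, hence fixed by conjugation. *)
Lemma error_generator_adjoint (G : oper R n -> oper R n) (E : eeg n -> Prop) X :
  error_generator_in E G -> (G X)^t* = G (X^t*).
Proof.
move=> [m [c [g [_ GE]]]]; rewrite !GE.
have -> (F : 'I_m -> oper R n) : (\sum_k F k)^t* = \sum_k (F k)^t*.
  by rewrite linear_sum /= map_mx_sum.
apply: eq_bigr => k _; rewrite adjointZ adjoint_eeg_map; congr (_ *: _).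
by rewrite conj_Creal // complex_real.
Qed.

End EventClass.

Theorem theorem1 (R : realType) (n : nat) (psi : ket R n) (DD D : {set pauli n})
    (G : oper R n -> oper R n)
    (hpsi : stabilizer_state psi)
    (hDD : detector_set psi DD)
    (hD : D \subset DD)
    (hG : error_generator_in (event_class R DD D) G) :
  forall P : pauli n, P \in D ->
  exists pD : R,
    [/\ of_real pD =
          2^-1 * (1 - \tr (pauli_op R P *m super_exp G (density psi))),
        perfectly_models DD (single_event_dem D pD) (super_exp G (density psi))
      & [/\ history_prob DD (super_exp G (density psi)) D = of_real pD,
            history_prob DD (super_exp G (density psi)) finset.set0
              = of_real (1 - pD)
          & forall S : {set pauli n}, S \subset DD -> S != D -> S != finset.set0 ->
              history_prob DD (super_exp G (density psi)) S = 0]].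
Proof.
move=> P0 P0D; case: hpsi => psi1 _; case: hDD => det comm _.
have inDD P : P \in D -> P \in DD by apply: (fintype.subsetP hD).
have [Gl eG] := linear_pack (error_generator_linear hG); subst G.
set rho := density psi; set E := super_exp Gl rho.
have rho_fix P : P \in DD -> pauli_op R P *m rho = rho.
  by move=> /det /(detector_stabilizes psi1) Ppsi; rewrite mulmxA Ppsi.
have trE : \tr E = 1.
  rewrite /E mxtrace_super_exp => [|Y]; last exact: (error_generator_trace _ hG).
  by rewrite mxtrace_mulC psi1 mxtrace1.
have adjE : E^t* = E.
  apply: adjoint_super_exp => [Y|]; first exact: (error_generator_adjoint _ hG).
  by rewrite /rho /density adjointM trmxCK.
have fixE P : P \in DD -> P \notin D -> pauli_op R P *m E = E.
  move=> PDD PD; apply: mulmx_super_exp => [Y|]; last exact: rho_fix.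
  by apply: (error_generator_mull _ hG) => g Q gD Qg; apply: event_class_comm gD Qg PDD PD.
have pairE P Q : P \in D -> Q \in D -> pauli_op R P *m (pauli_op R Q *m E) = E.
  move=> PD QD; rewrite mulmxA; apply: mulmx_super_exp => [Y|]; last first.
    by rewrite -mulmxA !rho_fix ?inDD.
  apply: (error_generator_mull _ hG) => g Q' gD Qg.
  (* Moving the product of the two detectors past an index produces two signs, which cancel. *)
  have := event_class_anticomm gD Qg QD; have := event_class_anticomm gD Qg PD.
  move: (pauli_op R P) (pauli_op R Q) (pauli_op R Q') => a b c ac bc.
  by rewrite [RHS]mulmxA -mulmxA bc mulmxN mulmxA ac mulNmx opprK.
have histE (S : {set pauli n}) (SDD : S \subset DD) := history_prob_decomp hD P0D SDD
  (fun P PDD => comm P P0 PDD (inDD _ P0D)) fixE pairE.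
set t := \tr (pauli_op R P0 *m E).
(* [E] and the Pauli are Hermitian, so conjugating the trace only swaps the two factors. *)
have t_conj : t^* = t.
  have <- : \tr ((pauli_op R P0 *m E)^t*) = t^* by rewrite trace_map_mx mxtrace_tr.
  by rewrite adjointM adjE pauli_op_adjoint mxtrace_mulC.
have p_real : 2^-1 * (1 - t) \is Num.real.
  by rewrite CrealE rmorphM fmorphV rmorphB /= t_conj rmorph1 rmorph_nat.
pose p : R := complex.Re (2^-1 * (1 - t)).
have pE : of_real p = 2^-1 * (1 - t) by rewrite /of_real RRe_real.
have qE : of_real (1 - p) = 2^-1 * (1 + t).
  rewrite /of_real rmorphB rmorph1 -[(_ p)]/(of_real p) pE.
  rewrite -[X in X - _](@mulVf _ 2) ?pnatr_eq0 // -mulrBr; congr (_ * _).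
  by rewrite opprB addrA addrAC -[2]/(1 + 1) addrK addrC.
(* The histories [D] and [set0] are distinct, so each receives exactly one term of [modelE]. *)
have D0 : D != finset.set0 by apply/set0Pn; exists P0.
have modelE (S : {set pauli n}) : S \subset DD -> history_prob DD E S
    = (S == finset.set0)%:R * of_real (1 - p) + (S == D)%:R * of_real p.
  by move=> SDD; rewrite histE // trE qE pE.
exists p; split; first exact: pE.
  move=> S SDD; rewrite modelE // dem_prob_single.
  by rewrite /of_real [RHS]rmorphD [in RHS]rmorphM [X in _ = _ + X]rmorphM !rmorph_nat.
split=> [||S SDD SD S0].
- by rewrite modelE // (negPf D0) eqxx mul0r mul1r add0r.
- by rewrite modelE ?finset.sub0set // eqxx eq_sym (negPf D0) mul0r mul1r addr0.
- by rewrite modelE // (negPf SD) (negPf S0) !mul0r addr0.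
Qed.
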